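(* Let $(R,\mathfrak{m})$ be a commutative Noetherian local ring. Then $R$ is regular if and only if there exists a maximal $R$-regular sequence $x_1,\dots,x_t$ such that $\mathfrak{m}$ is not linked by $(x_1,\dots,x_t)$.
   Context: Regular sequences (in $\mathfrak{m}$) may be empty ($t=0$, generating the zero ideal). An ideal $\mathfrak{a}$ is linked by an ideal $I$ generated by an $R$-regular sequence if $\mathfrak{a}$ is a non-zero proper ideal containing $I$ and there is a non-zero proper ideal $\mathfrak{b}\supseteq I$ with $\mathfrak{b}=I:_R\mathfrak{a}$ and $\mathfrak{a}=I:_R\mathfrak{b}$. *)

(* Defs.v *)
From mathcomp Require Import all_boot all_order all_algebra.
From mathcomp Require Import all_classical.
Set Implicit Arguments.
Unset Strict Implicit.
Unset Printing Implicit Defensive.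
Import GRing.Theory.
Local Open Scope classical_set_scope.
Local Open Scope ring_scope.

(* Ideals are Prop-valued sets, not the idealr / prime_idealr structures of    *)
(* ring_quotient: those are boolean predicates and must be proper, whereas     *)
(* colon ideals and generated ideals may be the whole ring.                    *)

Section CommutativeAlgebra.
Variable R : comNzRingType.
Implicit Types (A B I m P : set R) (s t : seq R) (n : nat).

Definition is_ideal A : Prop :=
  [/\ A 0,
      forall x y, A x -> A y -> A (x + y) &
      forall a x, A x -> A (a * x)].

Definition is_proper_ideal A : Prop := is_ideal A /\ A <> [set: R].

Definition is_nonzero_ideal A : Prop := is_ideal A /\ A <> [set 0].

Definition is_prime_ideal P : Prop :=
  is_proper_ideal P /\ forall x y, P (x * y) -> P x \/ P y.

Definition is_maximal_ideal m : Prop :=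
  is_proper_ideal m /\ forall A, is_proper_ideal A -> m `<=` A -> A = m.

(* (R, m) is local: m is the only maximal ideal of R. *)
Definition local_ring m : Prop :=
  is_maximal_ideal m /\ forall A, is_maximal_ideal A -> A = m.

(* The ideal generated by the entries of s; it is [set 0] for s = [::]. *)
Definition ideal_gen s : set R :=
  [set x | exists c : 'I_(size s) -> R, x = \sum_(i < size s) c i * s`_i].

Definition noetherian_ring : Prop :=
  forall A, is_ideal A -> exists s, A = ideal_gen s.

(* I :_R A *)
Definition colon I A : set R := [set r | forall a, A a -> I (r * a)].

Definition prime_chain n (p : 'I_n.+1 -> set R) : Prop :=
  (forall i, is_prime_ideal (p i)) /\
  (forall i j : 'I_n.+1, (i < j)%N -> p i `<` p j).

(* The Krull dimension of R is finite and equal to n. *)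
Definition has_krull_dim n : Prop :=
  (exists p : 'I_n.+1 -> set R, prime_chain p) /\
  (forall k (p : 'I_k.+1 -> set R), prime_chain p -> (k <= n)%N).

(* n is the minimal number of generators of A. *)
Definition has_min_gens A n : Prop :=
  (exists2 s, size s = n & A = ideal_gen s) /\
  (forall s, A = ideal_gen s -> (n <= size s)%N).

(* For (R, m) Noetherian local: R is regular when the minimal number of        *)
(* generators of m is the Krull dimension of R.                                *)
Definition regular_local_ring m : Prop :=
  exists n, has_krull_dim n /\ has_min_gens m n.

(* Each s_i is a nonzerodivisor on R / (s_0, ..., s_(i-1)), and R / (s) is     *)
(* nonzero.                                                                    *)
Definition regular_seq s : Prop :=
  (forall i, (i < size s)%N ->
     forall r, ideal_gen (take i s) (s`_i * r) -> ideal_gen (take i s) r) /\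
  ideal_gen s <> [set: R].

Definition regular_seq_in m s : Prop :=
  (forall x, x \in s -> m x) /\ regular_seq s.

(* Maximal means that s is not a proper initial segment of another regular     *)
(* sequence in m.                                                              *)
Definition maximal_regular_seq_in m s : Prop :=
  regular_seq_in m s /\
  forall t, regular_seq_in m (s ++ t) -> t = [::].

Definition linked_by A I : Prop :=
  [/\ is_nonzero_ideal A, is_proper_ideal A, I `<=` A &
      exists B, [/\ is_nonzero_ideal B, is_proper_ideal B, I `<=` B,
                    B = colon I A & A = colon I B]].

End CommutativeAlgebra.

Arguments noetherian_ring : clear implicits.
Arguments has_krull_dim : clear implicits.

(* Main.v *)
Require Import Defs.
From mathcomp Require Import all_boot all_order all_algebra.
From mathcomp Require Import all_classical.
From mathcomp Require Import ring.

(* Let I be generated by a maximal regular sequence x.  If I <> m, then R/I has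
   depth 0, so B = I : m properly contains I; since B is not contained in I, the
   proper ideal I : B is m, and m is linked by I through B.  If I = m, then
   I : m = R and m is not linked by I.  So the theorem says that R is regular
   iff m is generated by a regular sequence.

   If m = (x_1, ..., x_n) with x regular, Nakayama shows by descending induction
   that each (x_1, ..., x_i) is prime, which gives a chain of length n; Krull's
   height theorem bounds the dimension by n.  Conversely, let m = (x_1, ..., x_n)
   with n = dim R.  Krull's principal ideal theorem lets one modify a chain of
   primes so that its second member contains a given element of m, so that
   R/(x_1, ..., x_i) has dimension n - i; Nakayama then shows, again by descending
   induction, that the (x_1, ..., x_i) are distinct primes.

   Ideals of a localization R_r are represented by their contractions, the ideals
   of R closed under division by elements outside r. *)

Set Implicit Arguments.
Unset Strict Implicit.
Unset Printing Implicit Defensive.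
Import GRing.Theory.
Local Open Scope classical_set_scope.
Local Open Scope ring_scope.

(** * Ideals, contracted localizations and prime avoidance *)

Section Ideals.
Variable R : comNzRingType.
Implicit Types (A B I J P Q N M p q r m : set R) (s t : seq R).

Section Closure.
Variables (A : set R) (idA : is_ideal A).

Lemma ideal0 : A 0. Proof. by case: idA. Qed.

Lemma idealD x y : A x -> A y -> A (x + y).
Proof. by case: idA => _ h _; apply: h. Qed.

Lemma ideal_mull a x : A x -> A (a * x).
Proof. by case: idA => _ _; apply. Qed.

Lemma ideal_mulr a x : A x -> A (x * a).
Proof. by rewrite mulrC; apply: ideal_mull. Qed.

Lemma idealN x : A x -> A (- x).
Proof. by rewrite -mulN1r; apply: ideal_mull. Qed.

Lemma idealB x y : A x -> A y -> A (x - y).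
Proof. by move=> Ax Ay; apply: idealD => //; apply: idealN. Qed.

Lemma idealDr x y : A y -> A (x + y) -> A x.
Proof. by move=> Ay Axy; rewrite -(addrK y x); apply: idealB. Qed.

Lemma ideal_sum n (F : 'I_n -> R) : (forall i, A (F i)) -> A (\sum_i F i).
Proof.
move=> h; apply: (big_ind A) => //; [exact: ideal0|exact: idealD].
Qed.

Lemma ideal1 : A 1 -> A = [set: R].
Proof.
by move=> A1; apply/seteqP; split=> // x _; rewrite -(mulr1 x); apply: ideal_mull.
Qed.

Lemma proper_ideal1 : A <> [set: R] <-> ~ A 1.
Proof.
split=> h; last by move=> e; apply: h; rewrite e.
by move=> A1; apply: h; apply: ideal1.
Qed.

End Closure.

Lemma prime_ideal P : is_prime_ideal P -> is_ideal P.
Proof. by case=> [[]]. Qed.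

Lemma prime_proper P : is_prime_ideal P -> ~ P 1.
Proof. by case=> [[idP /(proper_ideal1 idP)]]. Qed.

Lemma prime_mul P x y : is_prime_ideal P -> P (x * y) -> P x \/ P y.
Proof. by case=> _; apply. Qed.

Lemma prime_nmul P x y : is_prime_ideal P -> ~ P x -> ~ P y -> ~ P (x * y).
Proof. by move=> prP nx ny /(prime_mul prP) []. Qed.

Lemma prime_exp P x n : is_prime_ideal P -> ~ P x -> ~ P (x ^+ n).
Proof.
move=> prP nx; elim: n => [|n IHn]; first by rewrite expr0; apply: prime_proper.
by rewrite exprS; apply: prime_nmul.
Qed.

Lemma ideal_gen_ideal s : is_ideal (ideal_gen s).
Proof.
split.
- by exists (fun=> 0); rewrite big1 // => i _; rewrite mul0r.
- move=> _ _ [c ->] [d ->]; exists (fun i => c i + d i).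
  by rewrite -big_split; apply: eq_bigr => i _; rewrite mulrDl.
- move=> a _ [c ->]; exists (fun i => a * c i).
  by rewrite mulr_sumr; apply: eq_bigr => i _; rewrite mulrA.
Qed.

Lemma mem_ideal_gen s x : x \in s -> ideal_gen s x.
Proof.
move=> xs; have h : (index x s < size s)%N by rewrite index_mem.
exists (fun i => (i == Ordinal h)%:R).
rewrite (bigD1 (Ordinal h)) //= eqxx mul1r nth_index // big1 ?addr0 // => i ni.
by rewrite (negbTE ni) mul0r.
Qed.

Lemma ideal_gen_sub s A :
  is_ideal A -> (forall x, x \in s -> A x) -> ideal_gen s `<=` A.
Proof.
move=> idA h _ [c ->]; apply: ideal_sum => // i.
by apply: ideal_mull => //; apply: h; apply: mem_nth.
Qed.

Lemma ideal_gen_subset s t : {subset s <= t} -> ideal_gen s `<=` ideal_gen t.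
Proof.
move=> st; apply: ideal_gen_sub; first exact: ideal_gen_ideal.
by move=> x /st; apply: mem_ideal_gen.
Qed.

Lemma ideal_gen_rcons s x z :
  ideal_gen (rcons s x) z <-> exists c, ideal_gen s (z - c * x).
Proof.
have idg := ideal_gen_ideal s; split.
  move: z; apply: ideal_gen_sub; last first.
    move=> y; rewrite mem_rcons inE => /orP[/eqP->|ys].
      by exists 1; rewrite mul1r subrr; apply: ideal0.
    by exists 0; rewrite mul0r subr0; apply: mem_ideal_gen.
  split.
  - by exists 0; rewrite mul0r subr0; apply: ideal0.
  - move=> y z [c hc] [d hd]; exists (c + d).
    by have -> : y + z - (c + d) * x = (y - c * x) + (z - d * x);
      [ring|apply: idealD].
  - move=> a y [c hc]; exists (a * c).
    by have -> : a * y - a * c * x = a * (y - c * x); [ring|apply: ideal_mull].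
case=> c hz; have idr := ideal_gen_ideal (rcons s x).
rewrite -(subrK (c * x) z); apply: idealD => //.
  by apply: ideal_gen_subset hz => y ys; rewrite mem_rcons inE ys orbT.
by apply: ideal_mull => //; apply: mem_ideal_gen; rewrite mem_rcons mem_head.
Qed.

Definition loc_closed r A := forall u a : R, ~ r u -> A (u * a) -> A a.

(* The contraction to [R] of the extension to [R_r] of [A + (x)]. *)
Definition locD r A x : set R :=
  [set z | exists u c, ~ r u /\ A (u * z - c * x)].

Section LocD.
Variables (r : set R) (prr : is_prime_ideal r) (A : set R) (idA : is_ideal A).

Lemma locD_ideal x : is_ideal (locD r A x).
Proof.
have r1 := prime_proper prr; split.
- by exists 1, 0; split=> //; rewrite mulr0 mul0r subr0; apply: ideal0.
- move=> y z [s [c [ns hc]]] [t [d [nt hd]]].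
  exists (s * t), (t * c + s * d); split; first exact: prime_nmul.
  have -> : s * t * (y + z) - (t * c + s * d) * x =
    t * (s * y - c * x) + s * (t * z - d * x) by ring.
  by apply: idealD => //; apply: ideal_mull.
- move=> a y [s [c [ns hc]]]; exists s, (a * c); split=> //.
  have -> : s * (a * y) - a * c * x = a * (s * y - c * x) by ring.
  exact: ideal_mull.
Qed.

Lemma locD_closed x : loc_closed r (locD r A x).
Proof.
move=> s a ns [t [c [nt h]]]; exists (t * s), c; split; first exact: prime_nmul.
by rewrite -mulrA.
Qed.

Lemma locD_subl x : A `<=` locD r A x.
Proof.
move=> z Az; exists 1, 0; split; first exact: prime_proper.
by rewrite mul1r mul0r subr0.
Qed.

Lemma locD_mem x : locD r A x x.
Proof.
exists 1, 1; split; first exact: prime_proper.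
by rewrite subrr; apply: ideal0.
Qed.

Lemma locD_min B x : is_ideal B -> loc_closed r B -> A `<=` B -> B x ->
  locD r A x `<=` B.
Proof.
move=> idB clB AB Bx z [s [c [ns h]]]; apply: (clB s) => //.
by rewrite -(subrK (c * x) (s * z)); apply: idealD; [|apply: AB|apply: ideal_mull].
Qed.

End LocD.

Lemma colon1_ideal I a : is_ideal I -> is_ideal [set z | I (z * a)].
Proof.
move=> idI; split=> /=.
- by rewrite mul0r; apply: ideal0.
- by move=> x y hx hy; rewrite mulrDl; apply: idealD.
- by move=> b x hx; rewrite -mulrA; apply: ideal_mull.
Qed.

Lemma common_multiple_avoid P (F : R -> set R) s : is_prime_ideal P ->
  (forall b, is_ideal (F b)) ->
  (forall b, b \in s -> exists2 z, F b z & ~ P z) ->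
  exists2 z, (forall b, b \in s -> F b z) & ~ P z.
Proof.
move=> prP idF; elim: s => [|b s IHs] h.
  by exists 1 => //; apply: prime_proper.
have [|z hz nz] := IHs; first by move=> c cs; apply: h; rewrite inE cs orbT.
have [w hw nw] := h b (mem_head _ _).
exists (z * w); last exact: prime_nmul.
move=> c; rewrite inE => /orP[/eqP->|cs]; first exact: ideal_mull.
by apply: ideal_mulr => //; apply: hz.
Qed.

(** Induction on [s]. If the [y] avoiding the later primes lies in [F b], add [w * z] with [w] in
    [J] outside [F b] and [z] in all later primes but not in [F b]. Such a [z] exists: a later prime
    inside [F b] would equal [F b] and contain [y]. *)
Lemma prime_avoidance J (F : R -> set R) s : is_ideal J ->
  (forall b, is_ideal (F b)) ->
  (forall b, b \in s -> is_prime_ideal (F b)) ->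
  (forall b c, b \in s -> c \in s -> F b `<=` F c -> F b = F c) ->
  (forall b, b \in s -> exists2 z, J z & ~ F b z) ->
  exists2 y, J y & forall b, b \in s -> ~ F b y.
Proof.
move=> idJ idF; elim: s => [|b s IHs] prF anti h.
  by exists 0 => //; apply: ideal0.
have inS c : c \in s -> c \in b :: s by rewrite inE => ->; rewrite orbT.
have [|||y Jy hy] := IHs.
- by move=> c /inS; apply: prF.
- by move=> c d /inS cs /inS ds; apply: anti.
- by move=> c /inS; apply: h.
have bs := mem_head b s.
have [Fy|nFy] := pselect (F b y); last first.
  by exists y => // c; rewrite inE => /orP[/eqP->//|]; apply: hy.
have [|z hz nz] := common_multiple_avoid (P := F b) (F := F) (s := s)
    (prF _ bs) idF.
  move=> c cs; apply: contrapT => /forall2NP hc.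
  have e : F c = F b.
    apply: anti => //; first exact: inS.
    by move=> w Fw; case: (hc w) => // /contrapT.
  by apply: (hy c) => //; rewrite e.
have [w Jw nw] := h b bs.
have prb := prF _ bs.
exists (y + w * z); first by apply: idealD => //; apply: ideal_mulr.
move=> c; rewrite inE => /orP[/eqP->|cs].
  move=> Fyz; apply: (prime_nmul prb nw nz).
  by apply: (idealDr (idF b) Fy); rewrite addrC.
move=> Fyz; apply: (hy c cs); apply: (idealDr (idF c)) Fyz.
by apply: ideal_mull => //; apply: hz.
Qed.

End Ideals.

(** * Noetherian rings: maximal ideals in families, local Nakayama, Krull's principal ideal
    theorem *)

Section Noetherian.
Variable R : comNzRingType.
Hypothesis noethR : noetherian_ring R.
Implicit Types (A B I J P Q N M p q r m : set R) (s t : seq R).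

Lemma noetherian_max (F : set (set R)) :
  F `<=` @is_ideal R -> F !=set0 ->
  exists A, F A /\ forall B, F B -> A `<=` B -> B = A.
Proof.
move=> Fid [A0 FA0].
(* [set0] is adjoined because the chain in Zorn's lemma may be empty. *)
have [|A [FA maxA]] := @Zorn_bigcup R (fun A => F A \/ A = set0).
  move=> G GF totG.
  have [[A1 GA1 FA1]|noG] := pselect (exists2 A, G A & F A); last first.
    right; apply/seteqP; split=> // x [A GA Ax].
    have [FA|A0'] := GF _ GA; last by rewrite A0' in Ax.
    by case: noG; exists A.
  set U := \bigcup_(X in G) X.
  have dir s : (forall x, x \in s -> U x) ->
      exists A, [/\ G A, F A & forall x, x \in s -> A x].
    elim: s => [|x s IHs] h; first by exists A1.
    have [y ys|A [GA FA sA]] := IHs; first by apply: h; rewrite inE ys orbT.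
    have [B GB Bx] := h x (mem_head _ _).
    have [AB|BA] := totG _ _ GA GB.
      exists B; split=> //; last first.
        by move=> y; rewrite inE => /orP[/eqP->//|/sA/AB].
      by have [|B0] := GF _ GB; last by rewrite B0 in Bx.
    exists A; split=> // y; rewrite inE => /orP[/eqP->|/sA//].
    exact: BA.
  have idU : is_ideal U.
    split.
    - by exists A1 => //; apply: ideal0; apply: Fid.
    - move=> x y Ux Uy; have [z|A [GA FA sA]] := dir [:: x; y].
        by rewrite !inE => /orP[]/eqP->.
      by exists A => //; apply: (idealD (Fid _ FA)); apply: sA;
        rewrite !inE eqxx ?orbT.
    - move=> a x Ux; have [z|A [GA FA sA]] := dir [:: x].
        by rewrite !inE => /eqP->.
      by exists A => //; apply: (ideal_mull (Fid _ FA)); apply: sA; rewrite inE.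
  (* The finitely many generators of [U] lie in a single member of the chain, which is then [U]. *)
  have [s Us] := noethR idU.
  have [x xs|A [GA FA sA]] := dir s; first by rewrite Us; apply: mem_ideal_gen.
  left; suff -> : U = A by [].
  apply/seteqP; split; last by move=> x Ax; exists A.
  by rewrite Us; apply: ideal_gen_sub => //; apply: Fid.
have FA' : F A.
  case: FA => // A0'; exfalso; apply: (maxA A0); last by left.
  by rewrite A0'; split=> // /(_ 0); apply; apply: ideal0; apply: Fid.
exists A; split=> // B FB AB; apply: contrapT => nBA.
apply: (maxA B); last by left.
by split=> // BA; apply: nBA; apply/seteqP.
Qed.

Lemma finite_gen_subset (F : set R) :
  exists s, (forall x, x \in s -> F x) /\ F `<=` ideal_gen s.
Proof.
have [||A [[s [sF ->]] maxA]] := @noetherian_max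
    [set A | exists s, (forall x, x \in s -> F x) /\ A = ideal_gen s].
- by move=> _ [s [_ ->]]; apply: ideal_gen_ideal.
- by exists (ideal_gen [::]), [::].
exists s; split=> // x Fx; rewrite -(maxA (ideal_gen (rcons s x))).
- by apply: mem_ideal_gen; rewrite mem_rcons mem_head.
- exists (rcons s x); split=> // y; rewrite mem_rcons inE => /orP[/eqP->//|].
  exact: sF.
- by apply: ideal_gen_subset => y ys; rewrite mem_rcons inE ys orbT.
Qed.

(** Modulo [I], the annihilator of [y * a] contains that of [a]; if [y * a] is nonzero, maximality
    makes them equal, so whatever kills [y * a] kills [a]. *)
Lemma max_colon1_prime I (F : set R) a : is_ideal I ->
  F a -> (forall b, F b -> ~ I b) ->
  (forall b c, F b -> ~ I (c * b) -> F (c * b)) ->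
  (forall b, F b -> [set z | I (z * a)] `<=` [set z | I (z * b)] ->
     [set z | I (z * b)] = [set z | I (z * a)]) ->
  is_prime_ideal [set z | I (z * a)].
Proof.
move=> idI Fa FnI Fmul maxa; have idc := colon1_ideal a idI; split.
  split=> //; apply/(proper_ideal1 idc) => /=; rewrite mul1r; exact: FnI.
move=> x y /= Ixya; have [Iya|nIya] := pselect (I (y * a)); first by right.
left; suff : [set z | I (z * a)] x by [].
rewrite -(maxa _ (Fmul _ _ Fa nIya)) /=; first by rewrite mulrA.
by move=> z /= Iza; rewrite mulrCA; apply: ideal_mull.
Qed.

(* Nakayama's lemma for [R_r]: the hypothesis says [M <= N + x M] there.  For a
   counterexample [a] with [N + (a)] maximal in [R_r], writing [u a = n + x c]
   gives [N + (a) = N + (c)], whence [c \in N + (x c)] and [c \in N]. *)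
Lemma local_nakayama r N M x : is_prime_ideal r -> r x ->
  is_ideal N -> loc_closed r N ->
  (forall a, M a -> exists u c, [/\ ~ r u, M c & N (u * a - c * x)]) ->
  M `<=` N.
Proof.
move=> prr rx idN clN h a Ma; apply: contrapT => nNa.
have [||A [[b [Mb nNb ->]] maxb]] := @noetherian_max
    [set A | exists b, [/\ M b, ~ N b & A = locD r N b]].
- by move=> _ [b [_ _ ->]]; apply: locD_ideal.
- by exists (locD r N a), a.
have [u [c [nu Mc Nbc]]] := h b Mb.
have nNc : ~ N c.
  move=> Nc; apply: nNb; apply: (clN u) => //.
  by rewrite -(subrK (c * x) (u * b)); apply: idealD => //; apply: ideal_mulr.
have sub : locD r N b `<=` locD r N c.
  apply: locD_min; [exact: locD_ideal|exact: locD_closed|exact: locD_subl|].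
  by exists u, x; rewrite (mulrC x).
have : locD r N c c by apply: locD_mem.
rewrite (maxb _ _ sub); last by exists c.
case=> v [d [nv Ncb]]; apply: nNc; apply: (clN (u * v - d * x)).
  move=> ruv; apply: (prime_nmul prr nu nv).
  rewrite -(subrK (d * x) (u * v)).
  by apply: (idealD (prime_ideal prr)) => //; apply: (ideal_mull (prime_ideal prr)).
have -> : (u * v - d * x) * c = u * (v * c - d * b) + d * (u * b - c * x).
  by ring.
by apply: idealD => //; apply: ideal_mull.
Qed.

(* Noetherian induction on [B]: that the [L k `&` B] are stationary passes from [B]
   to [B + (a)] when [r a `<=` B], the quotient being a line over [R_r / r]. *)
Lemma local_dcc r (A : set R) (L : nat -> set R) : is_prime_ideal r ->
  (forall P, is_prime_ideal P -> A `<=` P -> P `<=` r -> P = r) ->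
  (forall k, is_ideal (L k)) -> (forall k, loc_closed r (L k)) ->
  (forall k, A `<=` L k) -> (forall k, L k.+1 `<=` L k) ->
  exists K, forall k, L K `<=` L k.
Proof.
move=> prr onlyr idL clL AL decL.
have {}decL i j : (i <= j)%N -> L j `<=` L i.
  move=> /subnK <-; elim: (j - i)%N => // n IHn x; rewrite addSn => /decL.
  exact: IHn.
have [||B [[idB clB AB [K hK]] maxB]] := @noetherian_max
  [set B | [/\ is_ideal B, loc_closed r B, A `<=` B &
     exists K, forall k z, L K z -> B z -> L k z]].
- by move=> B [].
- exists (\bigcap_k L k); split.
  + split; first by move=> k _; apply: ideal0.
      by move=> x y hx hy k _; apply: idealD => //; [apply: hx|apply: hy].
    by move=> a x hx k _; apply: ideal_mull => //; apply: hx.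
  + by move=> u a nu h k _; apply: (clL k u) => //; apply: h.
  + by move=> x Ax k _; apply: AL.
  + by exists 0%N => k z _ /(_ k); apply.
have [B1|nB1] := pselect (B 1).
  by exists K => k z LKz; apply: hK => //; rewrite (ideal1 idB B1).
have [||C [[a [nBa ->]] maxa]] := @noetherian_max
    [set C | exists a, ~ B a /\ C = [set z | B (z * a)]].
- by move=> _ [a [_ ->]]; apply: colon1_ideal.
- by exists [set z | B (z * 1)], 1.
(* A maximal annihilator modulo [B] is prime; it contains [A], and it lies in [r] since [B] is
   closed under division outside [r]. *)
have colr : [set z | B (z * a)] = r.
  apply: onlyr.
  - apply: (max_colon1_prime (F := [set b | ~ B b])) => // b nBb sub.
    by apply: maxa => //; exists b.
  - by move=> z Az /=; apply: (ideal_mulr idB); apply: AB.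
  - by move=> z Bza; apply: contrapT => nrz; apply: nBa; apply: (clB z).
have ra z : r z -> B (z * a) by rewrite -colr.
have idB' := locD_ideal prr idB a.
exfalso; apply: nBa; rewrite -(maxB (locD r B a)); last exact: locD_subl.
  exact: locD_mem.
split=> //; first exact: locD_closed.
  by move=> z /AB; apply: locD_subl.
(* Either every [L k] contains some [w] congruent modulo [B] to a multiple [u * a] with [u] outside
   [r], and subtracting a multiple of [w] brings a multiple of [z] into [B]; or some [L k0] contains
   none, and from [k0] on [L k] meets [locD r B a] inside [B]. *)
have [hyp|nhyp] := pselect
    (forall k, exists w u, [/\ L k w, ~ r u & B (w - u * a)]).
  exists K => k z LKz [u [c [nu hz]]].
  have [lekK|leKk] := leqP k K; first exact: decL lekK _ LKz.
  have [w [v [Lw nv hw]]] := hyp k.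
  have LKw : L K w by apply: decL (ltnW leKk) _ Lw.
  have idLK := idL K; have idLk := idL k.
  apply: (clL k (v * u)); first exact: prime_nmul.
  have e : v * u * z - c * w = v * (u * z - c * a) - c * (w - v * a) by ring.
  rewrite -(subrK (c * w) (v * u * z)).
  apply: (idealD idLk); last exact: (ideal_mull idLk).
  apply: hK; last by rewrite e; apply: idealB => //; apply: ideal_mull.
  by apply: (idealB idLK); apply: (ideal_mull idLK).
move/existsNP : nhyp => [k0 hk0].
exists (maxn K k0) => k z Lz [u [c [nu hz]]].
apply: hK; first exact: decL (leq_maxl _ _) _ Lz.
have rc : r c.
  apply: contrapT => nrc; apply: hk0; exists (u * z), c; split=> //.
  by apply: (ideal_mull (idL k0)); apply: decL (leq_maxr _ _) _ Lz.
apply: (clB u) => //; rewrite -(subrK (c * a) (u * z)).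
by apply: (idealD idB) => //; apply: ra.
Qed.

(* Krull's principal ideal theorem.  Were [r] minimal over [p + (x)], the ideals
   [q_k + (x)], [q_k] the contraction of [p + y^k R_q], would be stationary in
   [R_r]; as [x] is regular modulo [q_k], Nakayama gives [q_K = q_(K+1)], and
   then [y] is a unit modulo [p] in [R_q]. *)
Lemma krull_pit p q r x : is_prime_ideal p -> is_prime_ideal q ->
  is_prime_ideal r -> p `<` q -> q `<` r -> r x ->
  exists2 q', is_prime_ideal q' & [/\ p `<` q', q' `<` r & q' x].
Proof.
move=> prp prq prr pq qr rx.
have [qx|nqx] := pselect (q x); first by exists q.
apply: contrapT => noq'.
have npx : ~ p x by move=> /(proj1 pq).
have idp := prime_ideal prp; have idq := prime_ideal prq.
have idr := prime_ideal prr.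
have [y [qy npy]] : exists y, q y /\ ~ p y.
  by have /nonsubset [y [qy npy]] := (proj2 pq); exists y.
pose Q k := locD q p (y ^+ k).
have idQ k : is_ideal (Q k) by apply: locD_ideal.
have clQ k : loc_closed q (Q k) by apply: locD_closed.
have pQ k : p `<=` Q k by apply: locD_subl.
have decQ k : Q k.+1 `<=` Q k.
  apply: locD_min => //; rewrite exprS; apply: ideal_mull => //.
  exact: locD_mem.
have nrq u : ~ r u -> ~ q u by move=> nru /(proj1 qr).
have [|||||K hK] := @local_dcc r (p `|` [set x]) (fun k => locD r (Q k) x) prr.
- move=> P prP AP Pr; apply: contrapT => nPr; apply: noq'; exists P => //.
  have Px : P x by apply: AP; right.
  split=> //.
    split; first by move=> z pz; apply: AP; left.
    by move/(_ x Px).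
  by split=> // rP; apply: nPr; apply/seteqP.
- by move=> k; apply: locD_ideal.
- by move=> k; apply: locD_closed.
- move=> k z [pz|->]; last exact: locD_mem.
  by apply: locD_subl => //; apply: pQ.
- move=> k; apply: locD_min; [exact: locD_ideal|exact: locD_closed| |].
    by move=> z /decQ; apply: locD_subl.
  exact: locD_mem.
have QK : Q K `<=` Q K.+1.
  apply: (local_nakayama prr rx) => //.
    by move=> u a /nrq; apply: clQ.
  move=> a QKa; have [u [c [nu h]]] : locD r (Q K.+1) x a.
    by apply: hK; apply: locD_subl.
  exists u, c; split=> //; apply: (clQ K x) => //; rewrite mulrC.
  have -> : c * x = u * a - (u * a - c * x) by ring.
  by apply: (idealB (idQ K)); [apply: ideal_mull|apply: decQ].
(* Here [(u - c * y) * y ^+ K] lies in [p] and [y] does not, so [u - c * y] is in [p]; with [y] in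
   [q] this puts [u] in [q]. *)
have [u [c [nu]]] : Q K.+1 (y ^+ K) by apply: QK; apply: locD_mem.
rewrite exprS mulrA -mulrBl => /(prime_mul prp)[|]; last exact: prime_exp.
move=> /(proj1 pq) quc; apply: nu; rewrite -(subrK (c * y) u).
by apply: idealD => //; apply: ideal_mull.
Qed.

End Noetherian.

(** * Chains of primes and Krull's height theorem *)

Section PrimeChains.
Variable R : comNzRingType.
Hypothesis noethR : noetherian_ring R.
Implicit Types (P Q m : set R) (s t : seq R).

(** Chains are unfolded from the bottom [P], with the top [Q] fixed, so that lower members can be
    exchanged by induction on [k]. *)
Fixpoint chain_to Q k P : Prop :=
  is_prime_ideal P /\
  if k is k'.+1 then exists2 P', P `<` P' & chain_to Q k' P' else P = Q.

Lemma chain_to_prime Q k P : chain_to Q k P -> is_prime_ideal P.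
Proof. by case: k => [|k] []. Qed.

Lemma chain_to_sub Q k P : chain_to Q k P -> P `<=` Q.
Proof.
elim: k P => [|k IHk] P /= [_]; first by move->.
by case=> P' [PP' _] /IHk P'Q x /PP' /P'Q.
Qed.

Lemma chain_to_extend Q m k P : is_prime_ideal m -> Q `<` m ->
  chain_to Q k P -> chain_to m k.+1 P.
Proof.
move=> prm Qm; elim: k P => [|k IHk] P.
  by move=> /= [prP PQ]; subst P; split=> //; exists m.
by case=> prP [P' PP' /IHk h]; split=> //; exists P'.
Qed.

Lemma prime_chain_to k (p : 'I_k.+1 -> set R) :
  prime_chain p -> chain_to (p ord_max) k (p ord0).
Proof.
elim: k p => [|k IHk] p [prp incp].
  by split=> //; congr p; apply: val_inj.
split=> //; exists (p (lift ord0 ord0)); first exact: incp.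
have -> : ord_max = lift ord0 ord_max :> 'I_k.+2 by apply: val_inj.
apply: (IHk (fun i => p (lift ord0 i))); split=> // i j ij; exact: incp.
Qed.

(** Membership of [x] is pushed down from [Q] one place at a time: once [x] is in [P2], [krull_pit]
    replaces the middle of [P], [P1], [P2] by a prime containing [x]. *)
Lemma chain_to_swap Q k P x : is_prime_ideal Q -> Q x -> chain_to Q k.+1 P ->
  exists P', [/\ P `<` P', P' x & chain_to Q k P'].
Proof.
move=> prQ Qx; elim: k P => [|k IHk] P [prP [P1 PP1 ch]].
  by exists P1; split=> //; case: ch => _ ->.
have [P2 [P12 P2x ch2]] := IHk _ ch.
have [P' prP' [PP' P'P2 P'x]] := krull_pit noethR prP (proj1 ch)
  (chain_to_prime ch2) PP1 P12 P2x.
by exists P'; split=> //; split=> //; exists P2.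
Qed.

(** Each swap absorbs one generator from [t] into the bottom prime and costs one inclusion; when [t]
    is exhausted the bottom is already the top. *)
Lemma krull_height s t k P : is_prime_ideal (ideal_gen (s ++ t)) ->
  ideal_gen s `<=` P -> chain_to (ideal_gen (s ++ t)) k P -> (k <= size t)%N.
Proof.
elim: t s k P => [|x t IHt] s [|k] P //.
  rewrite cats0 => _ sP [_ [P' [_ nP'P] /chain_to_sub P's]].
  by case: nP'P => z /P's /sP.
move=> prQ sP ch.
have Qx : ideal_gen (s ++ x :: t) x.
  by apply: mem_ideal_gen; rewrite mem_cat mem_head orbT.
have [P' [[PP' _] P'x ch']] := chain_to_swap prQ Qx ch.
have idP' := prime_ideal (chain_to_prime ch').
rewrite -cat_rcons in prQ ch'.
apply: (IHt (rcons s x) k P') => // z /ideal_gen_rcons[c h].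
rewrite -(subrK (c * x) z); apply: idealD => //; last exact: ideal_mull.
by apply: PP'; apply: sP.
Qed.

End PrimeChains.

(** * Noetherian local rings: units, Nakayama, chains ending at [m] *)

Section LocalRing.
Variables (R : comNzRingType) (m : set R).
Hypotheses (noethR : noetherian_ring R) (localR : local_ring m).
Implicit Types (A B I J P Q N M : set R) (s t : seq R).

Lemma local_ideal : is_ideal m.
Proof. by case: localR => [[[]]]. Qed.

Lemma local_proper1 : ~ m 1.
Proof.
by case: localR => [[[idm h] _] _]; apply/(proper_ideal1 idm).
Qed.

Lemma proper_ideal_sub A : is_proper_ideal A -> A `<=` m.
Proof.
move=> prA; have [||B [[prB AB] maxB]] := noetherian_max noethR
    (F := [set B | is_proper_ideal B /\ A `<=` B]).
- by move=> B [[]].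
- by exists A; split=> // z.
have <- // : B = m.
case: localR => _; apply; split=> // C prC BC; apply: maxB => //.
by split=> // x /AB /BC.
Qed.

Lemma local_unit x : ~ m x -> exists y, y * x = 1.
Proof.
move=> nmx; apply: contrapT => nox; apply: nmx.
have idx : is_ideal [set z | exists y, y * x = z].
  split; first by exists 0; rewrite mul0r.
  - by move=> _ _ [y <-] [z <-]; exists (y + z); rewrite mulrDl.
  - by move=> a _ [y <-]; exists (a * y); rewrite mulrA.
apply: (@proper_ideal_sub [set z | exists y, y * x = z]).
  by split=> //; apply/(proper_ideal1 idx).
by exists 1; rewrite mul1r.
Qed.

Lemma local_prime : is_prime_ideal m.
Proof.
split; first by case: localR => [[]].
move=> x y mxy; have [mx|/local_unit[z zx]] := pselect (m x); first by left.
right; rewrite -(mul1r y) -zx -mulrA; exact: (ideal_mull local_ideal).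
Qed.

Lemma local_closed N : is_ideal N -> loc_closed m N.
Proof.
move=> idN u a /local_unit[v vu] Nua.
by rewrite -(mul1r a) -vu -mulrA; apply: ideal_mull.
Qed.

Lemma nakayama N M x : m x -> is_ideal N ->
  (forall a, M a -> exists2 c, M c & N (a - c * x)) -> M `<=` N.
Proof.
move=> mx idN h; apply: (local_nakayama noethR local_prime mx) => //.
  exact: local_closed.
move=> a /h[c Mc Nc]; exists 1, c; rewrite mul1r; split=> //.
exact: local_proper1.
Qed.

(** A chain stopping below [m] is prolonged by [m], so only chains ending at [m] need to be
    bounded. *)
Lemma prime_chain_to_local k (p : 'I_k.+1 -> set R) : prime_chain p ->
  exists k' P, (k <= k')%N /\ chain_to m k' P.
Proof.
move=> /[dup] -[prp _] /prime_chain_to ch.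
have [pm|npm] := pselect (p ord_max = m).
  by exists k, (p ord0); rewrite -pm.
exists k.+1, (p ord0); split=> //; apply: chain_to_extend ch.
  exact: local_prime.
have pm : p ord_max `<=` m by apply: proper_ideal_sub; case: (prp ord_max).
by split=> // mp; apply: npm; apply/seteqP.
Qed.

(** This is the bound [dim R/(s_0, ..., s_(i-1)) <= size s - i]. *)
Lemma chain_to_local_le s i k P : m = ideal_gen s ->
  ideal_gen (take i s) `<=` P -> chain_to m k P -> (k <= size s - i)%N.
Proof.
move=> ms sP ch; rewrite -size_drop.
apply: (@krull_height R noethR (take i s) _ k P) => //;
  rewrite cat_take_drop -ms //; exact: local_prime.
Qed.

Lemma prime_chain_local_le s k (p : 'I_k.+1 -> set R) :
  m = ideal_gen s -> prime_chain p -> (k <= size s)%N.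
Proof.
move=> ms /prime_chain_to_local[k' [P [le ch]]]; apply: leq_trans le _.
rewrite -(subn0 (size s)); apply: (chain_to_local_le ms _ ch).
rewrite take0; apply: ideal_gen_sub => //.
exact: prime_ideal (chain_to_prime ch).
Qed.

Lemma mem_generators s i : m = ideal_gen s -> (i < size s)%N -> m s`_i.
Proof. by move=> -> si; apply: mem_ideal_gen; apply: mem_nth. Qed.

Lemma take_generators_prime s : m = ideal_gen s ->
  (forall i, (i < size s)%N -> is_prime_ideal (ideal_gen (take i.+1 s)) ->
     is_prime_ideal (ideal_gen (take i s))) ->
  forall i, (i <= size s)%N -> is_prime_ideal (ideal_gen (take i s)).
Proof.
move=> ms step i si; rewrite -(subKn si); elim: (size s - i)%N => [|j IHj].
  by rewrite subn0 take_size -ms; apply: local_prime.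
(* When [size s <= j], truncated subtraction makes [size s - j.+1] and [size s - j] both [0]. *)
have [ltj|lej] := ltnP j (size s); last first.
  by move: IHj; rewrite subnS; move: lej; rewrite -subn_eq0 => /eqP ->.
apply: step; last by rewrite -subSn // subSS.
by rewrite ltn_subrL /=; apply: leq_ltn_trans ltj.
Qed.

(** * Regular local rings: [dim R] generators of [m] form a maximal regular sequence *)

Section RegularLocal.
Variable s : seq R.
Hypotheses (ms : m = ideal_gen s) (dim : has_krull_dim R (size s)).

(** The reverse of the bound in [chain_to_local_le]: a chain of maximal length is swapped once for
    each of the first [i] generators. *)
Lemma regular_chain i : (i <= size s)%N ->
  exists2 P, ideal_gen (take i s) `<=` P & chain_to m (size s - i) P.
Proof.
elim: i => [|i IHi] si.
  case: dim => [[p /prime_chain_to_local[k [P [lek ch]]]] _].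
  have subP : ideal_gen (take 0 s) `<=` P.
    rewrite take0; apply: ideal_gen_sub => //.
    exact: prime_ideal (chain_to_prime ch).
  have := chain_to_local_le ms subP ch; rewrite subn0 => gek.
  by exists P => //; rewrite (_ : size s = k) //; apply/eqP; rewrite eqn_leq lek.
have [P sP] := IHi (ltnW si); rewrite subnS.
have : (0 < size s - i)%N by rewrite subn_gt0.
case: (size s - i)%N => // k _ /(chain_to_swap noethR local_prime
  (mem_generators ms si))[P' [[PP' _] P'x ch]].
have idP' := prime_ideal (chain_to_prime ch).
exists P' => // z; rewrite (take_nth 0 si) => /ideal_gen_rcons[c h].
rewrite -(subrK (c * s`_i) z); apply: idealD => //; last exact: ideal_mull.
by apply: PP'; apply: sP.
Qed.

(* The bottom [P] of a chain of length [size s - i] above [s_0, ..., s_(i-1)]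
   omits [s_i] and lies in the prime [(s_0, ..., s_i)]; so each of its elements
   is [c * s_i] modulo [(s_0, ..., s_(i-1))] with [c \in P], and Nakayama gives
   [P = (s_0, ..., s_(i-1))]. *)
Lemma regular_take_prime_step i : (i < size s)%N ->
  is_prime_ideal (ideal_gen (take i.+1 s)) ->
  is_prime_ideal (ideal_gen (take i s)) /\ ~ ideal_gen (take i s) s`_i.
Proof.
move=> si prS; have [P sP ch] := regular_chain (ltnW si).
have prP := chain_to_prime ch; have idP := prime_ideal prP.
have subS B : is_ideal B -> ideal_gen (take i s) `<=` B -> B s`_i ->
    ideal_gen (take i.+1 s) `<=` B.
  move=> idB sB Bx z; rewrite (take_nth 0 si) => /ideal_gen_rcons[c h].
  by rewrite -(subrK (c * s`_i) z); apply: idealD;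
    [|apply: sB|apply: ideal_mull].
have lenS k B : ideal_gen (take i.+1 s) `<=` B -> chain_to m k B ->
    (k < size s - i)%N.
  by move=> SB /(chain_to_local_le ms SB); rewrite -ltnS -subSn.
have nPx : ~ P s`_i.
  by move=> Px; have := lenS _ _ (subS _ idP sP Px) ch; rewrite ltnn.
have [P' [[PP' _] P'x ch']] : exists P', [/\ P `<` P', P' s`_i &
    chain_to m (size s - i).-1 P'].
  have : (0 < size s - i)%N by rewrite subn_gt0.
  case: (size s - i)%N ch => // k ch _.
  exact: (chain_to_swap noethR local_prime (mem_generators ms si)).
have SP' : ideal_gen (take i.+1 s) `<=` P'.
  apply: subS => //; first exact: prime_ideal (chain_to_prime ch').
  by move=> z /sP /PP'.
(* Otherwise the prime [(s_0, ..., s_i)] could be put below [P'], giving a chain one step longer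
   than [lenS] allows. *)
have P'S : P' `<=` ideal_gen (take i.+1 s).
  apply: contrapT => nP'S.
  have /lenS : chain_to m (size s - i).-1.+1 (ideal_gen (take i.+1 s)).
    by split=> //; exists P'.
  by rewrite prednK ?subn_gt0 // ltnn => /(_ (@subset_refl _ _)).
suff PE : P = ideal_gen (take i s) by rewrite -PE.
apply/seteqP; split=> //; apply: (nakayama (mem_generators ms si)).
  exact: ideal_gen_ideal.
move=> a Pa; have := P'S _ (PP' _ Pa).
rewrite (take_nth 0 si) => /ideal_gen_rcons[c h]; exists c => //.
have : P (c * s`_i).
  have -> : c * s`_i = a - (a - c * s`_i) by ring.
  by apply: idealB => //; apply: sP.
by case/(prime_mul prP).
Qed.

Lemma regular_take_prime i : (i <= size s)%N ->
  is_prime_ideal (ideal_gen (take i s)).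
Proof.
apply: take_generators_prime => // {}i si prS.
exact: (proj1 (regular_take_prime_step si prS)).
Qed.

Lemma regular_generators : maximal_regular_seq_in m s.
Proof.
split.
  split; first by move=> x xs; rewrite ms; apply: mem_ideal_gen.
  split; last by rewrite -ms; apply/(proper_ideal1 local_ideal)/local_proper1.
  move=> i si r.
  have [prP nPx] := regular_take_prime_step si (regular_take_prime si).
  by case/(prime_mul prP).
(* A further term [y] lies in [m = (s)], so regularity of [y] modulo [(s)], applied to [y * 1],
   would put [1] in [m]. *)
case=> // y t [inm [reg _]].
have my : m y by apply: inm; rewrite mem_cat mem_head orbT.
have := reg (size s); rewrite size_cat /= addnS ltnS leq_addr => /(_ isT 1).
rewrite take_size_cat // nth_cat ltnn subnn /= mulr1 -ms => /(_ my).
by move/local_proper1.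
Qed.

End RegularLocal.

(** * Linkage of [m], and regularity of [R] when a regular sequence generates [m] *)

Lemma not_linked_self : ~ linked_by m m.
Proof.
case=> _ _ _ [B [_ [idB /(proper_ideal1 idB) nB1] _ BE _]].
apply: nB1; rewrite BE => a ma; by rewrite mul1r.
Qed.

(* Elements of [R/I] whose annihilator is maximal have prime annihilators, and
   finitely many of them, [s], generate the others; so each such annihilator is
   one of finitely many primes, whose union is the set of zero divisors.  *)
Lemma socle_nonzero I : is_proper_ideal I ->
  (forall y, m y -> exists2 b, ~ I b & I (y * b)) ->
  exists2 a, ~ I a & forall y, m y -> I (y * a).
Proof.
move=> [idI nIT] zdiv; have nI1 := (proper_ideal1 idI).1 nIT.
pose ann a := [set z | I (z * a)].
have idann a : is_ideal (ann a) by apply: colon1_ideal.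
pose F := [set a | ~ I a /\ forall b, ~ I b -> ann a `<=` ann b -> ann b = ann a].
have prF a : F a -> is_prime_ideal (ann a).
  move=> [nIa maxa]; exact: (max_colon1_prime (F := [set b | ~ I b])).
apply: contrapT => nosocle.
have nFm a : F a -> exists2 y, m y & ~ ann a y.
  move=> [nIa _]; apply: contrapT => /forall2NP h; apply: nosocle.
  by exists a => // y my; have [] := h y => // /contrapT.
have [s [sF Fs]] := finite_gen_subset noethR F.
have [|||y my ny] := @prime_avoidance _ m ann s local_ideal idann.
- by move=> b /sF /prF.
- move=> b c /sF[_ maxb] /sF[nIc _] /maxb -> //.
- by move=> b /sF /nFm.
have [b nIb Iyb] := zdiv y my.
have [||C [[a [nIa ba ->]] maxa]] := noetherian_max noethR
  (F := [set C | exists a, [/\ ~ I a, ann b `<=` ann a & C = ann a]]).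
- by move=> _ [a [_ _ ->]].
- by exists (ann b), b; split=> // z.
have Fa : F a.
  split=> // c nIc ac; apply: maxa => //; exists c; split=> // z /ba /ac //.
have prA := prF a Fa.
(* [ann a] contains [y] and no [ann c] with [c] in [s] does; by maximality none of these lies in
   [ann a]. So some [z] outside [ann a] kills all of [s] modulo [I], hence also [a], a
   contradiction. *)
have [|z hz] := common_multiple_avoid (P := ann a) (s := s) prA idann.
  move=> c cs; apply: contrapT => /forall2NP h; apply: (ny c cs).
  have [nIc maxc] := sF c cs.
  have <- : ann a = ann c.
    by apply: maxc => // w cw; have [] := h w => // /contrapT.
  exact: ba.
apply; rewrite /ann /= mulrC; suff : [set w | I (w * z)] a by [].
apply: (ideal_gen_sub (colon1_ideal z idI) _ (Fs a Fa)) => c cs /=.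
by rewrite mulrC; apply: hz.
Qed.

Lemma regular_seq_rcons s y : regular_seq_in m s -> m y ->
  (forall b, ideal_gen s (y * b) -> ideal_gen s b) ->
  regular_seq_in m (s ++ [:: y]).
Proof.
move=> [sm [reg _]] my regy; rewrite cats1.
have inm x : x \in rcons s y -> m x.
  by rewrite mem_rcons inE => /orP[/eqP->//|/sm].
split=> //; split.
  move=> i; rewrite size_rcons ltnS leq_eqVlt => /orP[/eqP->|si].
    by rewrite nth_rcons ltnn eqxx -cats1 take_size_cat.
  rewrite nth_rcons si -cats1 takel_cat; [exact: reg|exact: ltnW].
apply/(proper_ideal1 (ideal_gen_ideal _)) => /(ideal_gen_sub local_ideal inm).
exact: local_proper1.
Qed.

Lemma linked_of_proper s : maximal_regular_seq_in m s -> ideal_gen s <> m ->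
  linked_by m (ideal_gen s).
Proof.
move=> [regs maxs] nsm; set I := ideal_gen s.
have idI : is_ideal I by apply: ideal_gen_ideal.
have Im : I `<=` m by case: regs => sm _; apply: ideal_gen_sub local_ideal sm.
have [mm nmT] : is_proper_ideal m by case: local_prime.
have pI : is_proper_ideal I by case: regs => _ [].
have nmI : ~ (m `<=` I) by move=> mI; apply: nsm; apply/seteqP.
(* An element of [m] regular modulo [I] could be appended to [s], against maximality. *)
have [y my|a nIa ma] := socle_nonzero pI.
  apply: contrapT => /forall2NP h.
  have /maxs // : regular_seq_in m (s ++ [:: y]).
  apply: regular_seq_rcons => // b Iyb.
  by have [/contrapT|] := h b.
have [z mz nIz] : exists2 z, m z & ~ I z.
  by have /nonsubset [z []] := nmI; exists z.
split=> //; first by split=> // m0; apply: nIz; move: mz; rewrite m0 => ->;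
  apply: ideal0.
have idB : is_ideal (colon I m).
  split.
  - by move=> b _; rewrite mul0r; apply: ideal0.
  - by move=> b c hb hc d md; rewrite mulrDl; apply: idealD;
      [|apply: hb|apply: hc].
  - by move=> b c hc d md; rewrite -mulrA; apply: ideal_mull => //; apply: hc.
have Ba : colon I m a by move=> y my; rewrite mulrC; apply: ma.
exists (colon I m); split=> //.
- by split=> // B0; apply: nIa; move: Ba; rewrite B0 => ->; apply: ideal0.
- split=> //; apply/(proper_ideal1 idB) => B1; apply: nmI => b mb.
  by rewrite -(mul1r b); apply: B1.
- by move=> b Ib c _; apply: ideal_mulr.
- apply/seteqP; split=> [b mb c Bc|b hb]; first by rewrite mulrC; apply: Bc.
  apply: contrapT => nmb; apply: nIa; apply: (local_closed idI nmb).
  exact: hb.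
Qed.

(* If [a b \in N] with [b \notin N] then [a \in (N, x)], say [a = n + c x], and
   [c b \in N] again. *)
Lemma prime_of_prime_rcons s x : m x ->
  (forall b, ideal_gen s (x * b) -> ideal_gen s b) ->
  is_prime_ideal (ideal_gen (rcons s x)) -> is_prime_ideal (ideal_gen s).
Proof.
set N := ideal_gen s; set P := ideal_gen _ => mx reg prP.
have idN : is_ideal N by apply: ideal_gen_ideal.
have NP : N `<=` P by apply: ideal_gen_subset => y ys; rewrite mem_rcons inE ys orbT.
have step a b : N (a * b) -> P a -> exists2 c, N (c * b) & N (a - c * x).
  move=> Nab /ideal_gen_rcons[c h]; exists c => //; apply: reg.
  have -> : x * (c * b) = a * b - b * (a - c * x) by ring.
  by apply: idealB => //; apply: ideal_mull.
have cancel b : ~ P b -> [set a | N (a * b)] `<=` N.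
  move=> nPb; apply: (nakayama mx idN) => a /= Nab; apply: step => //.
  by have := NP _ Nab => /(prime_mul prP)[].
split.
  split=> //; apply/(proper_ideal1 idN) => /NP; exact: prime_proper.
move=> a b Nab; apply: contrapT => /not_orP[nNa nNb].
(* If [a] were outside [P], [cancel] would put [b] in [N]; so [step] applies to every [a] with
   [a * b] in [N]. *)
apply: nNa; apply: (nakayama (M := [set a | N (a * b)]) mx idN) => // {Nab}a Nab.
apply: step => //; apply: contrapT => nPa; apply: nNb; apply: (cancel a) => //=.
by rewrite mulrC.
Qed.

Lemma regular_of_generators s : regular_seq_in m s -> m = ideal_gen s ->
  regular_local_ring m.
Proof.
move=> [sm [reg _]] ms.
have pr i : (i <= size s)%N -> is_prime_ideal (ideal_gen (take i s)).
  apply: take_generators_prime => // {}i si prS.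
  apply: (@prime_of_prime_rcons _ s`_i); [exact: mem_generators|exact: reg|].
  by rewrite -take_nth.
have chain : prime_chain (fun i : 'I_(size s).+1 => ideal_gen (take i s)).
  split; first by move=> i; apply: pr; rewrite -ltnS.
  move=> i j ij; have si : (i < size s)%N.
    by apply: leq_trans ij _; rewrite -ltnS.
  have sub : {subset take i.+1 s <= take j s}.
    by move=> z; rewrite -(take_takel s ij); apply: mem_take.
  split.
    apply: ideal_gen_subset => z zi; apply: sub.
    by rewrite (take_nth 0 si) mem_rcons inE zi orbT.
  have xj : ideal_gen (take j s) s`_i.
    by apply: mem_ideal_gen; apply: sub; rewrite (take_nth 0 si) mem_rcons mem_head.
  (* Strictness: were [s_i * 1] in the ideal of the first [i] terms, regularity would put [1] in
     that prime. *)
  move=> /(_ _ xj); rewrite -[s`_i in X in ideal_gen _ X]mulr1 => /(reg _ si).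
  by apply: prime_proper; apply: pr; apply: ltnW.
exists (size s); split; split.
- by exists (fun i => ideal_gen (take i s)).
- by move=> k p; apply: prime_chain_local_le.
- by exists s.
(* By the height theorem any generators [t] of [m] bound the length of the chain just built, whence
   [size s <= size t]. *)
- by move=> t mt; apply: prime_chain_local_le chain.
Qed.

End LocalRing.

Theorem theorem3p7 (R : comNzRingType) (m : set R)
    (noethR : noetherian_ring R) (localR : local_ring m) :
  regular_local_ring m <->
  exists x : seq R,
    maximal_regular_seq_in m x /\ ~ linked_by m (ideal_gen x).
Proof.
split=> [[n [dim [[s sn ms] _]]]|[s [maxs nlink]]].
  subst n; exists s; split; first exact: regular_generators.
  by rewrite -ms; apply: not_linked_self.
apply: (regular_of_generators noethR localR (proj1 maxs)).
apply: contrapT => nms; apply: nlink; apply: linked_of_proper => // sm.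
by apply: nms.
Qed.
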